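(* Suppose that $\mathcal{Z}$ and $\mathcal{A}$ are bornologies on an infinite set $X$ and either $\mathcal{A}\subseteq\mathcal{Z}$ or $\mathcal{A}=\mathcal{P}(X)$. For a family $\{A_n:n\in\omega\}$ consider the conditions: ($P_1$) for every $n\in\omega$, $\emptyset\neq A_n\subseteq\mathcal{A}\setminus\{\emptyset\}$; ($P_2$) for every $n\in\omega$, $\{z\in\mathcal{Z}:(\forall x\in A_n)\ x\cap z\neq\emptyset\}\neq\emptyset$. Then (in $\mathbf{ZF}$) the following conditions are equivalent: (i) $\mathbf{S}_{\mathcal{A}}(X,\mathcal{Z})$ is a $P$-space; (ii) for every family $\{A_n:n\in\omega\}$ satisfying ($P_1$) and ($P_2$), $\bigcap_{n\in\omega}\{z\in\mathcal{Z}:(\forall x\in A_n)\ x\cap z\neq\emptyset\}\neq\emptyset$; (iii) $\mathcal{Z}$ is a $\sigma$-ideal and, for every family $\{A_n:n\in\omega\}$ satisfying ($P_1$) and ($P_2$), the family $\{\{x\in\mathcal{Z}:(\forall z\in A_n)\ x\cap z\neq\emptyset\}:n\in\omega\}$ has a choice function.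
   Context: The background theory is $\mathbf{ZF}$ (no axiom of choice). For $\mathcal{A}\subseteq\mathcal{P}(X)$, $\mathbf{S}_{\mathcal{A}}(X,\mathcal{Z})$ is the set $\mathcal{A}$ with the topology $\tau_{\mathcal{A}}[\mathcal{Z}]$ consisting of all $V\subseteq\mathcal{A}$ such that for every $x\in V$ there is $z\in\mathcal{Z}$ with $x\cap z=\emptyset$ and $\{y\in\mathcal{A}:x\subseteq y\subseteq X\setminus z\}\subseteq V$. A bornology on $X$ is an ideal $\mathcal{I}$ of subsets of $X$ (closed under subsets and finite unions, possibly improper) with $\bigcup\mathcal{I}=X$. A $\sigma$-ideal is an ideal closed under unions $\bigcup_{n\in\omega}t_n$ of sequences of its members. A $P$-space is a topological space in which every $G_\delta$-set (countable intersection of open sets) is open. *)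

(* Defs.v *)
(* The theorem is a theorem of ZF, and one of its conditions is the existence of
   a choice function.  It is therefore stated inside an arbitrary model of
   first-order ZF: all sets, functions, sequences and natural numbers below are
   elements of the model, so that choice in the metatheory does not yield choice
   in the model.  By Goedel's completeness theorem, truth in all models is
   provability in ZF. *)

Record set_structure := SetStructure {
  carrier :> Type;
  mem : carrier -> carrier -> Prop
}.

Arguments mem {_} _ _.

Declare Scope zf_scope.
Open Scope zf_scope.
Notation "x ∈ y" := (mem x y) (at level 70, no associativity) : zf_scope.
Notation "x ∉ y" := (~ mem x y) (at level 70, no associativity) : zf_scope.

(* Formulas of the language {∈, =} with de Bruijn variables. *)
Inductive formula : Type :=
| f_mem (i j : nat)
| f_eq (i j : nat)
| f_bot
| f_imp (p q : formula)
| f_and (p q : formula)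
| f_or (p q : formula)
| f_all (p : formula)
| f_ex (p : formula).

Definition scons {T : Type} (x : T) (e : nat -> T) (n : nat) : T :=
  match n with O => x | S k => e k end.

Fixpoint sat (M : set_structure) (e : nat -> M) (p : formula) : Prop :=
  match p with
  | f_mem i j => e i ∈ e j
  | f_eq i j => e i = e j
  | f_bot => False
  | f_imp p q => sat M e p -> sat M e q
  | f_and p q => sat M e p /\ sat M e q
  | f_or p q => sat M e p \/ sat M e q
  | f_all p => forall x : M, sat M (scons x e) p
  | f_ex p => exists x : M, sat M (scons x e) p
  end.

(* [b = {x | P x}] *)
Definition set_of {M : set_structure} (b : M) (P : M -> Prop) : Prop :=
  forall x : M, x ∈ b <-> P x.

Definition subset {M : set_structure} (a b : M) : Prop :=
  forall x : M, x ∈ a -> x ∈ b.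
Notation "a ⊆ b" := (subset a b) (at level 70, no associativity) : zf_scope.

Definition is_empty {M : set_structure} (a : M) : Prop := forall x : M, x ∉ a.

Definition nonempty {M : set_structure} (a : M) : Prop := exists x : M, x ∈ a.

Definition disjoint {M : set_structure} (a b : M) : Prop :=
  forall x : M, ~ (x ∈ a /\ x ∈ b).

Definition inductive_set {M : set_structure} (w : M) : Prop :=
  (exists o : M, is_empty o /\ o ∈ w) /\
  (forall n : M, n ∈ w ->
     exists s : M, set_of s (fun x => x ∈ n \/ x = n) /\ s ∈ w).

Record ZF (M : set_structure) : Prop := {
  zf_extensionality :
    forall a b : M, (forall x : M, x ∈ a <-> x ∈ b) -> a = b;
  zf_foundation :
    forall a : M, nonempty a -> exists x : M, x ∈ a /\ disjoint x a;
  zf_pairing :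
    forall a b : M, exists c : M, set_of c (fun x => x = a \/ x = b);
  zf_union :
    forall a : M, exists u : M, set_of u (fun x => exists y : M, y ∈ a /\ x ∈ y);
  zf_powerset :
    forall a : M, exists p : M, set_of p (fun x => x ⊆ a);
  zf_infinity :
    exists w : M, inductive_set w;
  zf_separation :
    forall (p : formula) (e : nat -> M) (a : M),
      exists b : M, set_of b (fun x => x ∈ a /\ sat M (scons x e) p);
  zf_replacement :
    forall (p : formula) (e : nat -> M) (a : M),
      (forall x y y' : M, x ∈ a ->
         sat M (scons x (scons y e)) p -> sat M (scons x (scons y' e)) p ->
         y = y') ->
      exists b : M,
        set_of b (fun y => exists x : M, x ∈ a /\ sat M (scons x (scons y e)) p)
}.

Definition is_omega {M : set_structure} (w : M) : Prop :=
  inductive_set w /\ forall v : M, inductive_set v -> w ⊆ v.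

(* Kuratowski: [p = {{x}, {x, y}}] *)
Definition is_opair {M : set_structure} (p x y : M) : Prop :=
  set_of p (fun c => set_of c (fun t => t = x) \/
                     set_of c (fun t => t = x \/ t = y)).

Definition maps {M : set_structure} (f x y : M) : Prop :=
  exists p : M, is_opair p x y /\ p ∈ f.

Definition function_on {M : set_structure} (f d : M) : Prop :=
  (forall p : M, p ∈ f -> exists x y : M, is_opair p x y /\ x ∈ d) /\
  (forall x : M, x ∈ d -> exists! y : M, maps f x y).

Definition bijection {M : set_structure} (f a b : M) : Prop :=
  function_on f a /\
  (forall x y : M, maps f x y -> y ∈ b) /\
  (forall y : M, y ∈ b -> exists! x : M, maps f x y).

Definition infinite {M : set_structure} (a : M) : Prop :=
  ~ (exists w n f : M, is_omega w /\ n ∈ w /\ bijection f n a).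

(* A family [{F_n : n ∈ ω}]; "for every [n ∈ ω], ... [F_n] ..." is then
   "for all [n] and [a] with [maps F n a], ... [a] ...". *)
Definition omega_family {M : set_structure} (F : M) : Prop :=
  exists w : M, is_omega w /\ function_on F w.

Definition ideal {M : set_structure} (X I : M) : Prop :=
  (forall a : M, a ∈ I -> a ⊆ X) /\
  nonempty I /\
  (forall a b : M, a ∈ I -> b ⊆ a -> b ∈ I) /\
  (forall a b u : M, a ∈ I -> b ∈ I ->
     set_of u (fun x => x ∈ a \/ x ∈ b) -> u ∈ I).

Definition bornology {M : set_structure} (X I : M) : Prop :=
  ideal X I /\ set_of X (fun x => exists a : M, a ∈ I /\ x ∈ a).

Definition sigma_ideal {M : set_structure} (X I : M) : Prop :=
  ideal X I /\
  (forall F u : M, omega_family F ->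
     (forall n t : M, maps F n t -> t ∈ I) ->
     set_of u (fun x => exists n t : M, maps F n t /\ x ∈ t) ->
     u ∈ I).

Definition topology {M : set_structure} (S T : M) : Prop :=
  (forall U : M, U ∈ T -> U ⊆ S) /\
  (forall o : M, is_empty o -> o ∈ T) /\
  S ∈ T /\
  (forall C u : M, C ⊆ T ->
     set_of u (fun x => exists U : M, U ∈ C /\ x ∈ U) -> u ∈ T) /\
  (forall U V W : M, U ∈ T -> V ∈ T ->
     set_of W (fun x => x ∈ U /\ x ∈ V) -> W ∈ T).

Definition G_delta {M : set_structure} (T G : M) : Prop :=
  exists F : M, omega_family F /\
    (forall n U : M, maps F n U -> U ∈ T) /\
    set_of G (fun x => forall n U : M, maps F n U -> x ∈ U).

Definition P_space {M : set_structure} (S T : M) : Prop :=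
  topology S T /\ forall G : M, G_delta T G -> G ∈ T.

(* [T] is the topology [τ_A[Z]] on [A]. *)
Definition is_tau {M : set_structure} (X Z A T : M) : Prop :=
  set_of T (fun V =>
    V ⊆ A /\
    forall x : M, x ∈ V ->
      exists z : M, z ∈ Z /\ disjoint x z /\
        forall y : M, y ∈ A -> x ⊆ y ->
          (forall t : M, t ∈ y -> t ∈ X /\ t ∉ z) -> y ∈ V).

(* [z ∈ {z ∈ Z : (∀ x ∈ a) x ∩ z ≠ ∅}] *)
Definition meets_all {M : set_structure} (Z a z : M) : Prop :=
  z ∈ Z /\ forall x : M, x ∈ a -> ~ disjoint x z.

Definition P1 {M : set_structure} (A F : M) : Prop :=
  forall n a : M, maps F n a ->
    nonempty a /\ forall x : M, x ∈ a -> x ∈ A /\ ~ is_empty x.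

Definition P2 {M : set_structure} (Z F : M) : Prop :=
  forall n a : M, maps F n a -> exists z : M, meets_all Z a z.

Definition choice_function {M : set_structure} (f C : M) : Prop :=
  function_on f C /\ forall B b : M, maps f B b -> b ∈ B.

(* Main.v *)
(** The [G_delta] set attached to a family [A_n] is the intersection of the open
    sets [V_n = {y ∈ A : some z ∈ Z meets every member of A_n and misses y}].  It
    contains the empty set, and a basic neighbourhood [{y : y ∩ z = ∅}] of the
    empty set inside it is given by a [z] that meets every member of every [A_n].
    Conversely, for a point [x] of an intersection of open sets [V_n], a [z]
    meeting every nonempty [y] disjoint from [x] with [x ∪ y ∉ V_n], for all [n],
    gives (after removal of [x]) a neighbourhood of [x] inside the intersection.
    A common [z] yields a constant choice function, and covers the union of sets
    [t_n ∈ Z] when the [A_n] consist of the singletons of points of [t_n];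
    conversely, the union of the chosen sets is a common [z]. *)

Require Import Defs.
From Stdlib Require Import Classical.

Set Implicit Arguments.

Section ModelOfZF.

Context (M : set_structure) (hM : ZF M).

(** * Definability by first-order formulas, and the two axiom schemes *)

Definition definable (P : (nat -> M) -> Prop) : Prop :=
  exists p : formula, forall e : nat -> M, sat M e p <-> P e.

Lemma definable_mem i j : definable (fun e => e i ∈ e j).
Proof. exists (f_mem i j); simpl; tauto. Qed.

Lemma definable_eq i j : definable (fun e => e i = e j).
Proof. exists (f_eq i j); simpl; tauto. Qed.

Lemma definable_False : definable (fun _ => False).
Proof. exists f_bot; simpl; tauto. Qed.

Lemma definable_imp P Q :
  definable P -> definable Q -> definable (fun e => P e -> Q e).
Proof.
  intros [p hp] [q hq]; exists (f_imp p q); intro e; simpl.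
  rewrite (hp e), (hq e); tauto.
Qed.

Lemma definable_and P Q :
  definable P -> definable Q -> definable (fun e => P e /\ Q e).
Proof.
  intros [p hp] [q hq]; exists (f_and p q); intro e; simpl.
  rewrite (hp e), (hq e); tauto.
Qed.

Lemma definable_or P Q :
  definable P -> definable Q -> definable (fun e => P e \/ Q e).
Proof.
  intros [p hp] [q hq]; exists (f_or p q); intro e; simpl.
  rewrite (hp e), (hq e); tauto.
Qed.

(** [Q] takes the assignment and the bound element as separate arguments, so that [apply] matches a
    predicate under a quantifier. By conversion [scons x e] yields [x] at [0] and [e n] at [S n]. *)
Lemma definable_all (Q : (nat -> M) -> M -> Prop) :
  definable (fun e => Q (fun n => e (S n)) (e 0)) ->
  definable (fun e => forall x, Q e x).
Proof.
  intros [p hp]; exists (f_all p); intro e; simpl.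
  split; intros h x; apply (hp (scons x e)), h.
Qed.

Lemma definable_ex (Q : (nat -> M) -> M -> Prop) :
  definable (fun e => Q (fun n => e (S n)) (e 0)) ->
  definable (fun e => exists x, Q e x).
Proof.
  intros [p hp]; exists (f_ex p); intro e; simpl.
  split; intros [x h]; exists x; apply (hp (scons x e)), h.
Qed.

(* Quantifying over all placements of the arguments among the variables makes
   the notion stable under renaming of variables, with no operation on
   formulas. *)
Definition definable4 (Q : M -> M -> M -> M -> Prop) : Prop :=
  forall i j k l, definable (fun e => Q (e i) (e j) (e k) (e l)).

Ltac prove_definable :=
  unfold definable4; intros;
  unfold maps, is_opair, meets_all, disjoint, is_empty, subset, set_of, iff, not;
  repeat (cbv beta;
    first [ match goal with h : definable4 _ |- _ => apply h end
          | apply definable_mem | apply definable_eq | apply definable_False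
          | apply definable_and | apply definable_or | apply definable_imp
          | apply definable_ex | apply definable_all ]).

Lemma separation (Q : M -> M -> M -> M -> Prop) (hQ : definable4 Q) (a p q r : M) :
  exists b : M, set_of b (fun x => x ∈ a /\ Q x p q r).
Proof.
  destruct (hQ 0 1 2 3) as [phi hphi].
  (* Variables 0 to 3 stand for [x], [p], [q], [r]; beyond them the assignment takes the default
     value [r]. *)
  destruct (zf_separation _ hM phi (scons p (scons q (scons r (fun _ => r)))) a)
    as [b hb].
  exists b; intro x; rewrite (hb x), (hphi _); reflexivity.
Qed.

(** One placement of the variables is enough for [R], which is never put inside a larger predicate
    as the [Q] of [definable4] is. *)
Lemma replacement (R : M -> M -> M -> M -> M -> Prop)
  (hR : definable (fun e => R (e 0) (e 1) (e 2) (e 3) (e 4))) (a p q r : M) :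
  (forall x y y', x ∈ a -> R x y p q r -> R x y' p q r -> y = y') ->
  exists b : M, set_of b (fun y => exists x, x ∈ a /\ R x y p q r).
Proof.
  intro hfun.
  destruct hR as [phi hphi].
  destruct (zf_replacement _ hM phi (scons p (scons q (scons r (fun _ => r)))) a)
    as [b hb].
  - intros x y y' hx h h'; apply hphi in h, h'; exact (hfun x y y' hx h h').
  - exists b; intro y; rewrite (hb y).
    split; intros [x [hx h]]; exists x; split; auto.
    + apply hphi in h; exact h.
    + apply hphi; exact h.
Qed.

(** * Elementary set constructions and Kuratowski pairs *)

Lemma set_of_unique (P : M -> Prop) (a b : M) : set_of a P -> set_of b P -> a = b.
Proof.
  intros ha hb; apply (zf_extensionality _ hM); intro x.
  rewrite (ha x), (hb x); reflexivity.
Qed.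

Lemma singleton_exists (a : M) : exists s : M, set_of s (fun x => x = a).
Proof.
  destruct (zf_pairing _ hM a a) as [s hs]; exists s; intro x.
  rewrite (hs x); tauto.
Qed.

Lemma binary_union_exists (a b : M) :
  exists u : M, set_of u (fun x => x ∈ a \/ x ∈ b).
Proof.
  destruct (zf_pairing _ hM a b) as [c hc].
  destruct (zf_union _ hM c) as [u hu].
  exists u; intro x; rewrite (hu x); split.
  - intros [y [hy hx]]; apply hc in hy; destruct hy; subst; auto.
  - intros [hx | hx]; [exists a | exists b]; rewrite (hc _); auto.
Qed.

Lemma difference_exists (a b : M) :
  exists d : M, set_of d (fun x => x ∈ a /\ x ∉ b).
Proof.
  exact (@separation (fun x p _ _ => x ∉ p) ltac:(prove_definable) a b b b).
Qed.

Lemma opair_exists (x y : M) : exists p : M, is_opair p x y.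
Proof.
  destruct (singleton_exists x) as [s hs], (zf_pairing _ hM x y) as [d hd].
  destruct (zf_pairing _ hM s d) as [p hp].
  exists p; intro c; rewrite (hp c); split.
  - intros [-> | ->]; auto.
  - intros [h | h]; [left | right]; eapply set_of_unique; eauto.
Qed.

Lemma opair_unique (p q x y : M) : is_opair p x y -> is_opair q x y -> p = q.
Proof. apply set_of_unique. Qed.

(** The singleton [{x}] is a member of [p] and contains [x'] under either description of members, so
    [x = x']. Reading [{x, y}] and [{x, y'}] the same way locates [y] and [y']. *)
Lemma opair_inj (p x y x' y' : M) :
  is_opair p x y -> is_opair p x' y' -> x = x' /\ y = y'.
Proof.
  intros h h'.
  destruct (singleton_exists x) as [s hs], (zf_pairing _ hM x y) as [d hd].
  destruct (singleton_exists x') as [s' hs'], (zf_pairing _ hM x' y') as [d' hd'].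
  assert (sp : s ∈ p) by (apply h; auto).
  assert (dp : d ∈ p) by (apply h; auto).
  assert (sp' : s' ∈ p) by (apply h'; auto).
  assert (dp' : d' ∈ p) by (apply h'; auto).
  assert (ex : x = x').
  { apply h' in sp; destruct sp as [e | e].
    - apply e, hs; reflexivity.
    - symmetry; apply hs, e; auto. }
  subst x'; split; [reflexivity |].
  assert (hy : y = x \/ y = y').
  { apply h' in dp; destruct dp as [e | e].
    - left; apply e, hd; auto.
    - apply e, hd; auto. }
  assert (hy' : y' = x \/ y' = y).
  { apply h in dp'; destruct dp' as [e | e].
    - left; apply e, hd'; auto.
    - apply e, hd'; auto. }
  destruct hy, hy'; congruence.
Qed.

(** * Families indexed by ω and constant functions *)

Lemma omega_family_inhabited (F : M) :
  omega_family F -> exists n a : M, maps F n a.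
Proof.
  intros [w [[[[o [_ ho]] _] _] [_ hF]]].
  destruct (hF o ho) as [a [h _]]; eauto.
Qed.

Lemma omega_family_functional (F n a b : M) :
  omega_family F -> maps F n a -> maps F n b -> a = b.
Proof.
  intros [w [_ [hd hF]]] ha hb.
  assert (hn : n ∈ w).
  { destruct ha as [p [hp hpF]].
    destruct (hd p hpF) as [x [y [hp' hx]]].
    destruct (opair_inj hp hp'); subst; exact hx. }
  destruct (hF n hn) as [c [_ hc]].
  rewrite <- (hc a ha), <- (hc b hb); reflexivity.
Qed.

(** Each new value is defined outright from the old one by separation in [D], so no choice is made.
    Replacement acts on the graph of [F], sending the pair of [n] and [a] to the pair of [n] and
    [b]. *)
Lemma omega_family_image (Q : M -> M -> M -> M -> Prop) (hQ : definable4 Q)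
  (F D p q : M) :
  omega_family F ->
  exists G : M, omega_family G /\
    forall n b : M, maps G n b <->
      exists a : M, maps F n a /\ set_of b (fun x => x ∈ D /\ Q x a p q).
Proof.
  intro hF.
  destruct (@replacement (fun u v D p q => exists n a b,
    is_opair u n a /\ set_of b (fun x => x ∈ D /\ Q x a p q) /\ is_opair v n b)
    ltac:(prove_definable) F D p q) as [G hG].
  - intros u v v' _ [n [a [b [hu [hb hv]]]]] [n' [a' [b' [hu' [hb' hv']]]]].
    destruct (opair_inj hu hu'); subst n' a'.
    rewrite <- (set_of_unique hb hb') in hv'; exact (opair_unique hv hv').
  - assert (hmaps : forall n b : M, maps G n b <->
      exists a : M, maps F n a /\ set_of b (fun x => x ∈ D /\ Q x a p q)).
    { intros n b; split.
      - intros [v [hv hvG]]; apply hG in hvG.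
        destruct hvG as [u [huF [n' [a [b' [hu [hb hv']]]]]]].
        destruct (opair_inj hv hv'); subst n' b'.
        exists a; split; [exists u |]; auto.
      - intros [a [[u [hu huF]] hb]].
        destruct (opair_exists n b) as [v hv].
        exists v; split; [exact hv |].
        apply hG; exists u; split; [exact huF | exists n, a, b; auto]. }
    exists G; split; [| exact hmaps].
    destruct hF as [w [hw [hd hf]]].
    exists w; split; [exact hw | split].
    + intros v hv; apply hG in hv.
      destruct hv as [u [huF [n [a [b [hu [hb hv]]]]]]].
      exists n, b; split; [exact hv |].
      destruct (hd u huF) as [n' [a' [hu' hn]]].
      destruct (opair_inj hu hu'); subst; exact hn.
    + intros n hn; destruct (hf n hn) as [a [ha hau]].
      destruct (separation hQ D a p q) as [b hb].
      exists b; split.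
      * apply hmaps; eauto.
      * intros b' hb'; apply hmaps in hb'; destruct hb' as [a' [ha' hb']].
        rewrite <- (hau a' ha') in hb'; exact (set_of_unique hb hb').
Qed.

Lemma constant_function_exists (C z : M) :
  exists f : M, function_on f C /\ forall x y : M, maps f x y -> x ∈ C /\ y = z.
Proof.
  destruct (@replacement (fun x v z _ _ => is_opair v x z)
    ltac:(prove_definable) C z z z) as [f hf].
  - intros x v v' _; apply opair_unique.
  - assert (hm : forall x y : M, maps f x y -> x ∈ C /\ y = z).
    { intros x y [v [hv hvf]]; apply hf in hvf; destruct hvf as [x' [hx' hv']].
      destruct (opair_inj hv hv'); subst; auto. }
    exists f; split; [split | exact hm].
    + intros v hv; apply hf in hv; destruct hv as [x [hx hv]]; exists x, z; auto.
    + intros x hx; exists z; split.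
      * destruct (opair_exists x z) as [v hv].
        exists v; split; [exact hv | apply hf; exists x; auto].
      * intros y hy; destruct (hm x y hy); auto.
Qed.

(** * Bornologies and the topology they define *)

Lemma ideal_empty (X I o : M) : ideal X I -> is_empty o -> o ∈ I.
Proof.
  intros [_ [[a ha] [hsub _]]] ho.
  apply (hsub a o ha); intros x hx; destruct (ho x hx).
Qed.

Lemma bornology_singleton (X I t s : M) :
  bornology X I -> t ∈ X -> set_of s (fun x => x = t) -> s ∈ I.
Proof.
  intros [[_ [_ [hsub _]]] hcov] ht hs.
  apply hcov in ht; destruct ht as [a [ha hta]].
  apply (hsub a s ha); intros x hx; apply hs in hx; subst; exact hta.
Qed.

Lemma tau_exists (X Z A : M) : exists T : M, is_tau X Z A T.
Proof.
  destruct (zf_powerset _ hM A) as [P hP].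
  destruct (@separation (fun V X Z A =>
    forall x : M, x ∈ V ->
      exists z : M, z ∈ Z /\ disjoint x z /\
        forall y : M, y ∈ A -> x ⊆ y ->
          (forall t : M, t ∈ y -> t ∈ X /\ t ∉ z) -> y ∈ V)
    ltac:(prove_definable) P X Z A) as [T hT].
  - exists T; intro V; rewrite (hT V), (hP V); reflexivity.
Qed.

(** The empty set witnesses that the whole space is open, and the union of two witnesses, again in
    the ideal, serves for the intersection of two open sets. *)
Lemma tau_topology (X Z A T : M) : ideal X Z -> is_tau X Z A T -> topology A T.
Proof.
  intros hZ hT; split; [| split; [| split; [| split]]].
  - intros U hU; apply hT in hU; tauto.
  - intros o ho; apply hT; split; intros x hx; destruct (ho x hx).
  - apply hT; split; [intros x hx; exact hx |].
    intros x hx.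
    destruct (difference_exists A A) as [o ho].
    assert (hoe : is_empty o) by (intros t ht; apply ho in ht; tauto).
    exists o; split; [exact (ideal_empty hZ hoe) | split; [| auto]].
    intros t [_ ht]; exact (hoe t ht).
  - intros C u hC hu; apply hT; split.
    + intros x hx; apply hu in hx; destruct hx as [U [hU hx]].
      apply hC, hT in hU; destruct hU as [hU _]; auto.
    + intros x hx; apply hu in hx; destruct hx as [U [hU hx]].
      destruct (proj1 (hT U) (hC U hU)) as [_ hopen].
      destruct (hopen x hx) as [z [hz [hxz hV]]].
      exists z; split; [exact hz | split; [exact hxz |]].
      intros y hy hxy hyz; apply hu; exists U; auto.
  - intros U V W hU hV hW; apply hT in hU, hV; apply hT.
    destruct hU as [hUA hU], hV as [hVA hV]; split.
    + intros x hx; apply hW in hx; destruct hx; auto.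
    + intros x hx; apply hW in hx; destruct hx as [hxU hxV].
      destruct (hU x hxU) as [z [hz [hxz hz']]].
      destruct (hV x hxV) as [s [hs [hxs hs']]].
      destruct (binary_union_exists z s) as [u hu].
      exists u; split; [| split].
      * destruct hZ as [_ [_ [_ hcup]]]; exact (hcup z s u hz hs hu).
      * intros t [htx htu]; apply hu in htu; destruct htu.
        -- apply (hxz t); auto.
        -- apply (hxs t); auto.
      * intros y hy hxy hyu; apply hW; split; [apply hz' | apply hs']; auto;
          intros t ht; destruct (hyu t ht) as [htX htu]; split; auto;
          intro h; apply htu, hu; auto.
Qed.

(** * The P-space property and common meeting sets *)

(** This is condition (ii). *)
Definition omega_intersection_property (Z A : M) : Prop :=
  forall F : M, omega_family F -> P1 A F -> P2 Z F ->
    exists z : M, forall n a : M, maps F n a -> meets_all Z a z.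

Lemma P_space_intersection (X Z A T : M) :
  ideal X A -> is_tau X Z A T -> P_space A T ->
  omega_intersection_property Z A.
Proof.
  intros hA hT [_ hP] F hF h1 h2.
  (* [G] lists the sets V_n. The meeting set is quantified inside each V_n, so none is picked for
     each index. *)
  destruct (@omega_family_image
    (fun y a Z _ => exists z, meets_all Z a z /\ disjoint y z)
    ltac:(prove_definable) F A Z Z hF) as [G [hG hmaps]].
  destruct (@separation (fun y G _ _ => forall n V, maps G n V -> y ∈ V)
    ltac:(prove_definable) A G G G) as [W hW].
  assert (hWT : W ∈ T).
  { apply hP; exists G; split; [exact hG | split].
    - intros n V hV; apply hmaps in hV; destruct hV as [a [_ hV]].
      apply hT; split; [intros y hy; apply hV in hy; tauto |].
      intros x hx; apply hV in hx; destruct hx as [_ [z [hz hxz]]].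
      exists z; split; [apply hz | split; [exact hxz |]].
      intros y hy _ hyz; apply hV; split; [exact hy |].
      exists z; split; [exact hz |].
      intros t [hty htz]; destruct (hyz t hty); auto.
    (* [W] is cut out of [A]; a point of all V_n lies in [A] because there is at least one index. *)
    - intro y; rewrite (hW y); split; [tauto |].
      intro h; split; [| exact h].
      destruct (omega_family_inhabited hG) as [n [V hV]].
      assert (hy := h n V hV).
      apply hmaps in hV; destruct hV as [a [_ hV]]; apply hV in hy; tauto. }
  destruct (difference_exists A A) as [o ho].
  assert (hoe : is_empty o) by (intros t ht; apply ho in ht; tauto).
  assert (hoW : o ∈ W).
  { apply hW; split; [exact (ideal_empty hA hoe) |].
    intros n V hV; apply hmaps in hV; destruct hV as [a [ha hV]].
    apply hV; split; [exact (ideal_empty hA hoe) |].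
    destruct (h2 n a ha) as [z hz].
    exists z; split; [exact hz | intros t [ht _]; exact (hoe t ht)]. }
  destruct (proj2 (proj1 (hT W) hWT) o hoW) as [z [hz [_ hzW]]].
  exists z; intros n a ha; split; [exact hz |].
  intros x hx hxz.
  assert (hxA : x ∈ A) by (apply (h1 n a ha); exact hx).
  assert (hxW : x ∈ W).
  { apply hzW; [exact hxA | intros t ht; destruct (hoe t ht) |].
    intros t ht; split.
    - destruct hA as [hAX _]; exact (hAX x hxA t ht).
    - intro htz; apply (hxz t); auto. }
  (* V_n is rebuilt from [a] so that [hmaps] applies. A point [x] of it misses some [s] that meets
     every member of [a], among them [x] itself. *)
  destruct (@separation (fun y a Z _ => exists z, meets_all Z a z /\ disjoint y z)
    ltac:(prove_definable) A a Z Z) as [V hV].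
  assert (hxV : x ∈ V) by (apply hW in hxW; apply (proj2 hxW n), hmaps; eauto).
  apply hV in hxV; destruct hxV as [_ [s [[_ hs] hxs]]].
  exact (hs x hx hxs).
Qed.

Lemma intersection_P_space (X Z A T : M) :
  bornology X Z -> bornology X A -> is_tau X Z A T ->
  omega_intersection_property Z A -> P_space A T.
Proof.
  intros hZ hA hT hint; split; [exact (tau_topology (proj1 hZ) hT) |].
  destruct (proj1 hZ) as [hZX [_ [hZsub hZcup]]].
  destruct (proj1 hA) as [hAX [_ [hAsub hAcup]]].
  intros G [F [hF [hFT hG]]].
  assert (hGA : G ⊆ A).
  { intros y hy.
    destruct (omega_family_inhabited hF) as [n [V hV]].
    apply (proj1 (proj1 (hT V) (hFT n V hV))), (proj1 (hG y) hy n V hV). }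
  apply hT; split; [exact hGA |]; intros x hx.
  (* If [x] is all of [X], its only superset in [A] is [x], and the empty set is a witness. *)
  destruct (classic (exists t, t ∈ X /\ t ∉ x)) as [[t [htX htx]] | hfull].
  2:{ destruct (difference_exists A A) as [o ho].
      assert (hoe : is_empty o) by (intros t ht; apply ho in ht; tauto).
      exists o; split; [exact (ideal_empty (proj1 hZ) hoe) | split].
      - intros t [_ ht]; exact (hoe t ht).
      - intros y hy hxy _.
        replace y with x; [exact hx |].
        apply (zf_extensionality _ hM); intro t; split; [apply hxy |].
        intro hty; apply NNPP; intro htx; apply hfull.
        exists t; split; [exact (hAX y hy t hty) | exact htx]. }
  destruct (singleton_exists t) as [s hs].
  (* [{t}] is thrown in only to make every member of the family nonempty. *)
  destruct (@omega_family_image (fun y V x s =>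
      y = s \/ (~ is_empty y /\ disjoint y x /\
        forall u, set_of u (fun r => r ∈ x \/ r ∈ y) -> u ∉ V))
    ltac:(prove_definable) F A x s hF) as [H [hH hmaps]].
  assert (hsA : s ∈ A) by exact (bornology_singleton hA htX hs).
  assert (hsZ : s ∈ Z) by exact (bornology_singleton hZ htX hs).
  destruct (hint H hH) as [z hz].
  - intros n a ha; apply hmaps in ha; destruct ha as [V [hV ha]]; split.
    + exists s; apply ha; auto.
    + intros y hy; apply ha in hy; destruct hy as [hyA [-> | hy]];
        split; try tauto.
      intro h; apply (h t), hs; reflexivity.
  - intros n a ha; apply hmaps in ha; destruct ha as [V [hV ha]].
    assert (hxV : x ∈ V) by exact (proj1 (hG x) hx n V hV).
    destruct (proj2 (proj1 (hT V) (hFT n V hV)) x hxV) as [z [hz [hxz hzV]]].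
    (* A [y] missing the witness [z] would put [x ∪ y] in the basic neighbourhood of [x], hence in
       [V]. Adding [s] makes the union meet [{t}] too. *)
    destruct (binary_union_exists z s) as [u hu].
    exists u; split; [exact (hZcup z s u hz hsZ hu) |].
    intros y hy hyu; apply ha in hy; destruct hy as [hyA [-> | [_ [_ hy]]]].
    + apply (hyu t); split; [| apply hu; right]; apply hs; reflexivity.
    + destruct (binary_union_exists x y) as [v hv].
      apply (hy v hv), hzV.
      * exact (hAcup x y v (hGA x hx) hyA hv).
      * intros r hr; apply hv; auto.
      * intros r hr; apply hv in hr; destruct hr as [hr | hr]; split.
        -- exact (hAX x (hGA x hx) r hr).
        -- intro hrz; apply (hxz r); auto.
        -- exact (hAX y hyA r hr).
        -- intro hrz; apply (hyu r); split; [exact hr | apply hu; auto].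
  (* Removing [x] makes the common set disjoint from [x] and keeps its intersections with sets
     disjoint from [x]. *)
  - destruct (difference_exists z x) as [d hd].
    assert (hzZ : z ∈ Z).
    { destruct (omega_family_inhabited hH) as [n [a ha]]; apply (hz n a ha). }
    exists d; split; [| split].
    + apply (hZsub z d hzZ); intros r hr; apply hd in hr; tauto.
    + intros r [hrx hrd]; apply hd in hrd; tauto.
    + intros y hy hxy hyd; apply hG; intros n V hV; apply NNPP; intro hyV.
      (* As [x ⊆ y], the union of [x] and [c] is [y]. If [y] is outside [V], then [c] is nonempty
         (otherwise [y] is [x], a point of [V]) and belongs to the family, so [z] meets [c]; but [y]
         misses [d]. *)
      destruct (difference_exists y x) as [c hc].
      destruct (@separation (fun y V x s =>
          y = s \/ (~ is_empty y /\ disjoint y x /\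
          forall u, set_of u (fun r => r ∈ x \/ r ∈ y) -> u ∉ V))
        ltac:(prove_definable) A V x s) as [a ha].
      assert (hVa : maps H n a) by (apply hmaps; eauto).
      assert (hyc : forall u, set_of u (fun r => r ∈ x \/ r ∈ c) -> u = y).
      { intros u hu; apply (zf_extensionality _ hM); intro r.
        rewrite (hu r), (hc r); specialize (hxy r).
        destruct (classic (r ∈ x)); tauto. }
      apply (proj2 (hz n a hVa) c).
      * apply ha; split.
        { apply (hAsub y c hy); intros r hr; apply hc in hr; tauto. }
        right; split; [| split].
        -- intro hce; apply hyV.
           rewrite <- (hyc x); [exact (proj1 (hG x) hx n V hV) |].
           intro r; specialize (hce r); tauto.
        -- intros r [hrc hrx]; apply hc in hrc; tauto.
        -- intros u hu; rewrite (hyc u hu); exact hyV.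
      * intros r [hrc hrz]; apply hc in hrc; destruct hrc as [hry hrx].
        apply (proj2 (hyd r hry)), hd; auto.
Qed.

(** * Countable unions and choice functions *)

Lemma intersection_sigma_ideal (X Z A : M) :
  ideal X Z -> bornology X A ->
  omega_intersection_property Z A -> sigma_ideal X Z.
Proof.
  intros hZ hA hint; split; [exact hZ |].
  intros F u hF hFZ hu.
  destruct (classic (is_empty u)) as [he | hne]; [exact (ideal_empty hZ he) |].
  apply not_all_not_ex in hne; destruct hne as [p hp].
  apply hu in hp; destruct hp as [m [c [hc hpc]]].
  assert (hcZ := hFZ m c hc).
  destruct hZ as [hZX [_ [hsub hcup]]].
  (* The singleton of [p] keeps every A_n nonempty, even where t_n is empty. *)
  destruct (@omega_family_image (fun y t p _ =>
      exists s, set_of y (fun r => r = s) /\ (s ∈ t \/ s = p))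
    ltac:(prove_definable) F A p p hF) as [H [hH hmaps]].
  destruct (hint H hH) as [z hz].
  - intros n a ha; apply hmaps in ha; destruct ha as [t [ht ha]]; split.
    + destruct (singleton_exists p) as [s hs].
      exists s; apply ha; split; [| exists p; auto].
      exact (bornology_singleton hA (hZX c hcZ p hpc) hs).
    + intros y hy; apply ha in hy; destruct hy as [hyA [s [hs _]]].
      split; [exact hyA |]; intro h; apply (h s), hs; reflexivity.
  - intros n a ha; apply hmaps in ha; destruct ha as [t [ht ha]].
    (* [c] is a term of the sequence containing [p]; it makes the union meet [{p}]. *)
    destruct (binary_union_exists t c) as [v hv].
    exists v; split; [exact (hcup t c v (hFZ n t ht) hcZ hv) |].
    intros y hy hyv; apply ha in hy; destruct hy as [_ [s [hs hst]]].
    apply (hyv s); split; [apply hs; reflexivity |].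
    apply hv; destruct hst; subst; auto.
  - assert (hzZ : z ∈ Z).
    { destruct (omega_family_inhabited hH) as [n [a ha]]; apply (hz n a ha). }
    apply (hsub z u hzZ); intros s hsu; apply hu in hsu.
    destruct hsu as [n [t [ht hst]]].
    destruct (@separation (fun y t p _ =>
        exists s, set_of y (fun r => r = s) /\ (s ∈ t \/ s = p))
      ltac:(prove_definable) A t p p) as [a ha].
    destruct (singleton_exists s) as [y hy].
    apply NNPP; intro hsz.
    apply (proj2 (hz n a (proj2 (hmaps n a) (ex_intro _ t (conj ht ha)))) y).
    + apply ha; split; [| exists s; auto].
      exact (bornology_singleton hA (hZX t (hFZ n t ht) s hst) hy).
    + intros r [hr hrz]; apply hy in hr; subst; auto.
Qed.

(** The family in condition (iii) is taken as a set: indices with the same meeting sets give one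
    member, to which a choice function assigns one value. *)
Lemma meeting_sets_exist (F Z : M) :
  exists C : M,
    set_of C (fun B => exists n a : M, maps F n a /\ set_of B (meets_all Z a)).
Proof.
  destruct (zf_powerset _ hM Z) as [P hP].
  destruct (@separation (fun B F Z _ =>
    exists n a, maps F n a /\ set_of B (meets_all Z a))
    ltac:(prove_definable) P F Z Z) as [C hC].
  exists C; intro B; rewrite (hC B), (hP B); split; [tauto |].
  intros [n [a [ha hB]]]; split; [| eauto].
  intros z hz; apply hB in hz; apply hz.
Qed.

Lemma choice_intersection (X Z F C f : M) :
  sigma_ideal X Z -> omega_family F ->
  set_of C (fun B => exists n a : M, maps F n a /\ set_of B (meets_all Z a)) ->
  choice_function f C ->
  exists z : M, forall n a : M, maps F n a -> meets_all Z a z.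
Proof.
  intros [[hZX _] hsigma] hF hC [[_ hf] hchoice].
  (* The last clause makes the chosen [c] depend on [a] alone, the set of meeting sets being unique
     by extensionality. *)
  assert (hval : forall n a : M, maps F n a -> exists B c : M,
    set_of B (meets_all Z a) /\ maps f B c /\ meets_all Z a c /\
    forall B' c' : M, set_of B' (meets_all Z a) -> maps f B' c' -> c' = c).
  { intros n a ha.
    destruct (@separation (fun z Z a _ => meets_all Z a z)
      ltac:(prove_definable) Z Z a a) as [B hB].
    assert (hB' : set_of B (meets_all Z a)).
    { intro z; rewrite (hB z); unfold meets_all; tauto. }
    destruct (hf B) as [c [hc huniq]]; [apply hC; eauto |].
    exists B, c; split; [exact hB' | split; [exact hc | split]].
    - apply hB', (hchoice B c hc).
    - intros B' c' h h'; rewrite (set_of_unique h hB') in h'.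
      symmetry; auto. }
  (* [H] sends [n] to the set chosen for A_n, given through its points because image families are
     built by separation; [hin] identifies the two. *)
  destruct (@omega_family_image (fun x a Z f =>
      exists B c, set_of B (meets_all Z a) /\ maps f B c /\ x ∈ c)
    ltac:(prove_definable) F X Z f hF) as [H [hH hmaps]].
  assert (hin : forall n a c : M, maps F n a -> meets_all Z a c ->
    (forall B' c' : M, set_of B' (meets_all Z a) -> maps f B' c' -> c' = c) ->
    forall B, set_of B (meets_all Z a) -> maps f B c -> maps H n c).
  { intros n a c ha [hcZ _] hu B hB hc; apply hmaps; exists a; split; [exact ha |].
    intro x; split.
    - intro hx; split; [exact (hZX c hcZ x hx) | eauto].
    - intros [_ [B' [c' [h [h' hx]]]]]; rewrite <- (hu B' c' h h'); exact hx. }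
  destruct (zf_union _ hM Z) as [U hU].
  destruct (@separation (fun x H _ _ => exists n t, maps H n t /\ x ∈ t)
    ltac:(prove_definable) U H H H) as [u hu].
  assert (hHZ : forall n t : M, maps H n t -> t ∈ Z).
  { intros n t ht.
    destruct (proj1 (hmaps n t) ht) as [a [ha _]].
    destruct (hval n a ha) as [B [c [hB [hc [hca hun]]]]].
    rewrite (omega_family_functional hH ht (hin n a c ha hca hun B hB hc)).
    apply hca. }
  exists u; intros n a ha.
  destruct (hval n a ha) as [B [c [hB [hc [hca hun]]]]].
  assert (hHc := hin n a c ha hca hun B hB hc).
  assert (hu' : set_of u (fun x => exists n t : M, maps H n t /\ x ∈ t)).
  { intro x; rewrite (hu x), (hU x); split; [tauto |].
    intros [m [t [ht hx]]]; split; [exists t | exists m, t]; eauto. }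
  split; [exact (hsigma H u hH hHZ hu') |].
  (* The chosen [c] meets [x] and is contained in the union [u]. *)
  intros x hx hxu; apply (proj2 hca x hx); intros r [hrx hrc].
  apply (hxu r); split; [exact hrx | apply hu'; eauto].
Qed.

End ModelOfZF.

Unset Implicit Arguments.

Theorem theorem3p9 (M : set_structure) (hM : ZF M) (X Z A : M)
  (hX : infinite X) (hZ : bornology X Z) (hA : bornology X A)
  (hAZ : A ⊆ Z \/ set_of A (fun a => a ⊆ X)) :
  let cond_i :=
    exists T : M, is_tau X Z A T /\ P_space A T in
  let cond_ii :=
    forall F : M, omega_family F -> P1 A F -> P2 Z F ->
      exists z : M, forall n a : M, maps F n a -> meets_all Z a z in
  let cond_iii :=
    sigma_ideal X Z /\
    forall F : M, omega_family F -> P1 A F -> P2 Z F ->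
      exists C : M,
        set_of C (fun B => exists n a : M, maps F n a /\ set_of B (meets_all Z a)) /\
        exists f : M, choice_function f C in
  (cond_i <-> cond_ii) /\ (cond_ii <-> cond_iii).
Proof.
  intros cond_i cond_ii cond_iii; split; split.
  - intros [T [hT hP]].
    exact (P_space_intersection hM (proj1 hA) hT hP).
  - intro hint; destruct (tau_exists hM X Z A) as [T hT].
    exists T; split; [exact hT |].
    exact (intersection_P_space hM hZ hA hT hint).
  - intro hint; split; [exact (intersection_sigma_ideal hM (proj1 hZ) hA hint) |].
    intros F hF h1 h2.
    destruct (meeting_sets_exist hM F Z) as [C hC].
    destruct (hint F hF h1 h2) as [z hz].
    (* The common [z] belongs to every member of [C], so the constant value [z] is a legitimate
       choice. *)
    destruct (constant_function_exists hM C z) as [f [hf hfz]].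
    exists C; split; [exact hC | exists f; split; [exact hf |]].
    intros B b hb; destruct (hfz B b hb) as [hB ->].
    apply hC in hB; destruct hB as [n [a [ha hB]]]; apply hB; eauto.
  - intros [hsigma hchoice] F hF h1 h2.
    destruct (hchoice F hF h1 h2) as [C [hC [f hf]]].
    exact (choice_intersection hM hsigma hF hC hf).
Qed.
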